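(* Let $(X,\tau)$ be a topological space with a scope function $\mathfrak{a}$, and let $\mathcal{I}=\mathcal{I}_f$ be the ideal of finite subsets of $X$. Then: (i) For every $A\subseteq X$, $A^{\mathfrak{a}}(\mathcal{I}_f)=\{x\in X:\mathfrak{a}(x)\cap A\text{ is infinite}\}$. (ii) If $X$ is finite, then $A^{\mathfrak{a}}(\mathcal{I}_f)=\emptyset$ for all $A\subseteq X$, and $\tau^{*}_{\mathfrak{a}}=\mathcal{P}(X)$. (iii) Let $X=\mathbb{R}$ with the usual topology and, for $\varepsilon>0$, $\mathfrak{a}_\varepsilon(x)=(x-\varepsilon,x+\varepsilon)$. Then $A^{\mathfrak{a}_\varepsilon}(\mathcal{I}_f)$ consists of all points $x$ such that $(x-\varepsilon,x+\varepsilon)\cap A$ is infinite, and for any infinite $A\subseteq\mathbb{R}$ with no isolated points, $A^{\mathfrak{a}_\varepsilon}(\mathcal{I}_f)=\operatorname{cl}_{\mathfrak{a}_\varepsilon}(A)$.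
   Context: A scope function on a topological space $(X,\tau)$ is a function $\mathfrak{a}:X\to\tau$ with $x\in\mathfrak{a}(x)$ for every $x\in X$. For an ideal $\mathcal{I}$ on $X$ (a non-empty collection of subsets closed under subsets and finite unions) and $A\subseteq X$: $A^{\mathfrak{a}}(\mathcal{I})=\{x\in X:\mathfrak{a}(x)\cap A\notin\mathcal{I}\}$; $\operatorname{cl}_{\mathfrak{a}}(A)=\{x\in X:\mathfrak{a}(x)\cap A\neq\emptyset\}$; $\operatorname{cl}^{*}_{\mathfrak{a}}(A)=A\cup A^{\mathfrak{a}}(\mathcal{I})$; $\operatorname{cl}^{*0}_{\mathfrak{a}}(A)=A$, $\operatorname{cl}^{*(n+1)}_{\mathfrak{a}}(A)=\operatorname{cl}^{*}_{\mathfrak{a}}(\operatorname{cl}^{*n}_{\mathfrak{a}}(A))$, $\operatorname{cl}^{*\infty}_{\mathfrak{a}}(A)=\bigcup_{n=0}^{\infty}\operatorname{cl}^{*n}_{\mathfrak{a}}(A)$; and $\tau^{*}_{\mathfrak{a}}=\{A\subseteq X:\operatorname{cl}^{*\infty}_{\mathfrak{a}}(X\setminus A)=X\setminus A\}$. A set $A\subseteq\mathbb{R}$ has no isolated points if no point of $A$ is isolated in the subspace $A$. *)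

(* Defs.v *)
From mathcomp Require Import all_boot all_order all_algebra.
From mathcomp Require Import all_classical all_reals all_analysis.
Import Order.TTheory GRing.Theory Num.Theory.
Import numFieldNormedType.Exports.

Set Implicit Arguments.
Unset Strict Implicit.
Unset Printing Implicit Defensive.

Local Open Scope classical_set_scope.
Local Open Scope ring_scope.

Record scope_function (X : topologicalType) := ScopeFunction {
  scope :> X -> set X;
  scope_open : forall x, open (scope x);
  scope_mem : forall x, scope x x }.

Record set_ideal (X : Type) := SetIdeal {
  ideal_sets :> set X -> Prop;
  ideal_nonempty : exists A, ideal_sets A;
  ideal_sub : forall A B, B `<=` A -> ideal_sets A -> ideal_sets B;
  ideal_setU : forall A B, ideal_sets A -> ideal_sets B ->
    ideal_sets (A `|` B) }.

Section scope_closures.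
Context {X : topologicalType} (a : scope_function X).

Definition scope_cl (A : set X) : set X := [set x | a x `&` A !=set0].

Context (I : set_ideal X).

Definition scope_local (A : set X) : set X := [set x | ~ I (a x `&` A)].

Definition scope_cl_star (A : set X) : set X := A `|` scope_local A.

Definition scope_cl_star_iter (n : nat) (A : set X) : set X :=
  iter n scope_cl_star A.

Definition scope_cl_star_infty (A : set X) : set X :=
  \bigcup_n scope_cl_star_iter n A.

Definition scope_tau_star : set (set X) :=
  [set A | scope_cl_star_infty (~` A) = ~` A].

End scope_closures.

Section finite_ideal.
Context (X : Type).

Lemma finite_set_nonempty : exists A : set X, finite_set A.
Proof. by exists set0; exact: finite_set0. Qed.

Lemma finite_set_setU (A B : set X) :
  finite_set A -> finite_set B -> finite_set (A `|` B).
Proof. by move=> fA fB; rewrite finite_setU. Qed.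

Definition finite_ideal : set_ideal X :=
  SetIdeal finite_set_nonempty (fun A B => @sub_finite_set X B A) finite_set_setU.

End finite_ideal.

Section interval_scope.
Context {R : realType} (e : R).

Lemma interval_scope_open (x : R) : open (`]x - e, x + e[%classic : set R).
Proof. exact: interval_open. Qed.

Hypothesis e_gt0 : 0 < e.

Lemma interval_scope_mem (x : R) : `]x - e, x + e[%classic x.
Proof. by rewrite /= in_itv /= ltrBlDr ltrDl e_gt0. Qed.

Definition interval_scope : scope_function R :=
  ScopeFunction interval_scope_open interval_scope_mem.

End interval_scope.

(* Main.v *)
Require Import Defs.
From mathcomp Require Import all_boot all_order all_algebra.
From mathcomp Require Import all_classical all_reals all_analysis.
Import Order.TTheory GRing.Theory Num.Theory.
Import numFieldNormedType.Exports.
Set Implicit Arguments.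
Unset Strict Implicit.
Unset Printing Implicit Defensive.
Local Open Scope classical_set_scope.
Local Open Scope ring_scope.

(** The descriptions of the local set hold by unfolding, infinite being the negation of finite. On a
    finite space every set lies in the ideal, so local sets are empty and the closure operator fixes
    every set. On the line, an infinite trace is nonempty; conversely [isolated0_infinite_setI]
    makes a nonempty trace on an open set infinite. *)

Lemma isolated0_limit_point (T : topologicalType) (A : set T) :
  isolated A = set0 -> A `<=` limit_point A.
Proof.
move=> A0 x Ax; have := closure_isolated_limit_point A.
by rewrite A0 set0U => <-; exact: subset_closure.
Qed.

(** The point common to [U] and [A] is a limit point of [A], and on the line every neighbourhood of
    a limit point, here [U], meets [A] infinitely often. *)
Lemma isolated0_infinite_setI (R : archiRealFieldType) (A U : set R) :
  isolated A = set0 -> open U -> U `&` A !=set0 -> infinite_set (U `&` A).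
Proof.
move=> A0 oU [x [Ux Ax]].
have /limit_point_infinite_setP := isolated0_limit_point A0 Ax.
by apply; exact: open_nbhs_nbhs.
Qed.

(** One closure step adds nothing to [A], so the iteration is stationary from the start. *)
Lemma scope_cl_star_infty_id (X : topologicalType) (a : scope_function X)
    (I : set_ideal X) (A : set X) :
  scope_local a I A = set0 -> scope_cl_star_infty a I A = A.
Proof.
move=> A0; have iterA n : scope_cl_star_iter a I n A = A.
  elim: n => // n IHn.
  by rewrite /scope_cl_star_iter iterS -/(scope_cl_star_iter a I n A) IHn
    /scope_cl_star A0 setU0.
apply/seteqP; split=> [x [n _]|x Ax]; first by rewrite iterA.
by exists 0%N.
Qed.

Theorem proposition8p2 :
  (forall (X : topologicalType) (a : scope_function X),
     (forall A : set X,
        scope_local a (finite_ideal X) A = [set x | infinite_set (a x `&` A)])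
     /\
     (finite_set [set: X] ->
        (forall A : set X, scope_local a (finite_ideal X) A = set0)
        /\ scope_tau_star a (finite_ideal X) = [set: set X]))
  /\
  (forall (R : realType) (e : R) (e_gt0 : 0 < e),
     (forall A : set R,
        scope_local (interval_scope e_gt0) (finite_ideal R) A =
        [set x | infinite_set (`]x - e, x + e[ `&` A)])
     /\
     (forall A : set R, infinite_set A -> isolated A = set0 ->
        scope_local (interval_scope e_gt0) (finite_ideal R) A =
        scope_cl (interval_scope e_gt0) A)).
Proof.
split=> [X a|R e e_gt0].
  split=> // finX.
  have local0 A : scope_local a (finite_ideal X) A = set0.
    apply/seteqP; split=> // x; apply.
    exact: (sub_finite_set (@subsetT _ _) finX).
  split=> //; apply/seteqP; split=> // A _.
  exact: scope_cl_star_infty_id.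
split=> // A _ A0; apply/seteqP; split=> x.
  exact: infinite_setN0.
(* The limit point is the one found in the interval around [x], not [x] itself, which may lie
   outside [A]. *)
exact: isolated0_infinite_setI A0 (scope_open _ x).
Qed.
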